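(* Let $(X,f)$ be a quasi-continuous dynamical system. Suppose that $X$ is a space of the second category with a countable $\pi$-base $\mathscr P=\{P_n:n\in\mathbb N\}$. If $(X,f)$ satisfies $\mathrm{TT}_+$, then $(X,f)$ satisfies $\mathrm{DO}_+$. If in addition $X$ is a Baire space (and $(X,f)$ satisfies $\mathrm{TT}_+$), then $\mathrm{Trans}_f$ contains a dense $G_\delta$-set of $X$.
   Context: $\mathbb N$ denotes the set of nonnegative integers. A dynamical system is a pair $(X,f)$ where $X$ is a topological space (with at least two points) and $f:X\to X$ is a map, not necessarily continuous. A map $g:X\to Y$ between topological spaces is quasi-continuous if for every $x_0\in X$, every open neighbourhood $W$ of $g(x_0)$ and every open neighbourhood $U$ of $x_0$, there is a nonempty open set $V\subseteq U$ with $g(V)\subseteq W$. The system $(X,f)$ is quasi-continuous if $f^n$ is quasi-continuous for every $n\in\mathbb N$. A space is of the second category if it is not a countable union of nowhere dense subsets of itself. A $\pi$-base for $X$ is a family $\mathscr P$ of nonempty open subsets of $X$ such that every nonempty open $U\subseteq X$ contains some $P\in\mathscr P$. TT$_+$: for every pair of nonempty open sets $U,V\subseteq X$ there is $n\in\mathbb N$ with $f^n(U)\cap V\neq\emptyset$. The forward orbit is $\mathrm{Orb}_f(x)=\{f^n(x):n\in\mathbb N\}$. $\mathrm{Trans}_f$ is the set of transitive points, i.e. points $x\in X$ with $\mathrm{Orb}_f(x)$ dense in $X$. DO$_+$ (point transitivity): there is $x\in X$ with $\mathrm{Orb}_f(x)$ dense in $X$. *)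

(* Defs.v *)
From mathcomp Require Import all_boot.
From mathcomp Require Import boolp classical_sets functions.
From mathcomp Require Import topology borel_hierarchy.

Set Implicit Arguments.
Unset Strict Implicit.
Unset Printing Implicit Defensive.

Local Open Scope classical_set_scope.

Definition quasi_continuous (X Y : topologicalType) (g : X -> Y) : Prop :=
  forall (x0 : X) (W : set Y) (U : set X),
    open W -> W (g x0) -> open U -> U x0 ->
    exists V : set X, [/\ open V, V !=set0, V `<=` U & g @` V `<=` W].

(* Quasi-continuity is not preserved by composition, so it is required of
   every iterate. *)
Definition quasi_continuous_system (X : topologicalType) (f : X -> X) : Prop :=
  forall n : nat, quasi_continuous (iter n f).

Definition nowhere_dense (X : topologicalType) (A : set X) : Prop :=
  (closure A)° = set0.

Definition second_category (X : topologicalType) : Prop :=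
  ~ exists2 F : nat -> set X,
      forall n, nowhere_dense (F n) & [set: X] = \bigcup_n F n.

Definition Baire_space (X : topologicalType) : Prop :=
  forall F : nat -> set X,
    (forall n, open (F n) /\ dense (F n)) -> dense (\bigcap_n F n).

Definition pi_base (X : topologicalType) (B : set (set X)) : Prop :=
  (forall A, B A -> open A /\ A !=set0) /\
  (forall U : set X, open U -> U !=set0 -> exists2 A, B A & A `<=` U).

Definition TT_plus (X : topologicalType) (f : X -> X) : Prop :=
  forall U V : set X, open U -> U !=set0 -> open V -> V !=set0 ->
    exists n : nat, (iter n f @` U) `&` V !=set0.

Definition Orb (X : Type) (f : X -> X) (x : X) : set X :=
  range (fun n : nat => iter n f x).

Definition Trans (X : topologicalType) (f : X -> X) : set X :=
  [set x | dense (Orb f x)].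

Definition DO_plus (X : topologicalType) (f : X -> X) : Prop :=
  exists x : X, dense (Orb f x).

(* Main.v *)
Require Import Defs.
From mathcomp Require Import all_boot.
From mathcomp Require Import boolp classical_sets functions.
From mathcomp Require Import topology borel_hierarchy.

Local Open Scope classical_set_scope.

(** Let [D n := robust_hitting f (P n)], the open set of points having a
neighbourhood that a single iterate of [f] maps into [P n].  A point lying in
every [D n] has an orbit that meets every [P n], hence every nonempty open set:
it is transitive ([bigcap_robust_hitting_Trans]).  Each [D n] is dense
([dense_robust_hitting]): by TT_+ some iterate sends a point of a given open
set into [P n], and quasi-continuity of that iterate, though weaker than
continuity at the point, still provides a nonempty open subset sent into
[P n].  So the transitive points contain a countable intersection of dense open
sets.  In a space of the second category such an intersection is nonempty
([bigcap_open_dense_neq0]), and in a Baire space it is a dense G_delta. *)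

(** Taking interiors of the preimages [(f^k)^-1 W] makes this set open although
the iterates need not be continuous. *)
Definition robust_hitting {X : topologicalType} (f : X -> X) (W : set X) :
  set X := \bigcup_k (iter k f @^-1` W)°.

Lemma open_robust_hitting (X : topologicalType) (f : X -> X) (W : set X) :
  open (robust_hitting f W).
Proof. by apply: bigcup_open => k _; exact: open_interior. Qed.

(** Quasi-continuity thickens the single hitting point given by TT_+ to a
nonempty open set of points that hit [W] at the same time. *)
Lemma dense_robust_hitting (X : topologicalType) (f : X -> X) (W : set X) :
  quasi_continuous_system f -> TT_plus f -> open W -> W !=set0 ->
  dense (robust_hitting f W).
Proof.
move=> f_qc f_tt Wo W0 U U0 Uo.
have [k [_ [[x Ux <-] Wfx]]] := f_tt U W Uo U0 Wo W0.
have [V [Vo [y Vy] VU fVW]] := f_qc k x W U Wo Wfx Uo Ux.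
exists y; split; first exact: VU.
have : V `<=` iter k f @^-1` W by move=> z Vz; apply: fVW; exists z.
by rewrite open_subsetE // => VfW; exists k => //; exact: VfW.
Qed.

Lemma bigcap_robust_hitting_Trans {X : topologicalType} (f : X -> X)
    (P : nat -> set X) :
  pi_base (range P) -> \bigcap_n robust_hitting f (P n) `<=` Trans f.
Proof.
move=> [_ Pbase] x Dx U U0 Uo.
have [_ [n _ <-] PU] := Pbase U Uo U0.
have [k _ /interior_subset Pfx] := Dx n I.
by exists (iter k f x); split; [exact: PU | exists k].
Qed.

Lemma nowhere_dense_setC (X : topologicalType) (A : set X) :
  open A -> dense A -> nowhere_dense (~` A).
Proof.
move=> Ao Ad; rewrite /nowhere_dense -subset0 => x Ix.
have [y [Iy Ay]] := Ad _ (ex_intro _ x Ix) (open_interior _).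
have Ac : closed (~` A) by exact: open_closedC.
by have := interior_subset Iy; rewrite -(iffLR (closure_id _) Ac) => /(_ Ay).
Qed.

(** Otherwise the complements would be countably many nowhere dense sets
covering the space. *)
Lemma bigcap_open_dense_neq0 {X : topologicalType} (F : nat -> set X) :
  second_category X -> (forall n, open (F n) /\ dense (F n)) ->
  \bigcap_n F n !=set0.
Proof.
move=> X_cat2 Fod; apply/set0P/eqP => F0; apply: X_cat2.
exists (fun n => ~` F n).
  by move=> n; have [? ?] := Fod n; exact: nowhere_dense_setC.
by rewrite -setC_bigcap F0 setC0.
Qed.

Theorem theorem4p3 (X : topologicalType) (f : X -> X) (P : nat -> set X)
    (two_points : exists x y : X, x <> y)
    (f_qc : quasi_continuous_system f)
    (X_cat2 : second_category X)
    (P_pibase : pi_base (range P)) :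
  (TT_plus f -> DO_plus f) /\
  (Baire_space X -> TT_plus f ->
     exists G : set X, [/\ Gdelta G, dense G & G `<=` Trans f]).
Proof.
have Dod : TT_plus f ->
    forall n, open (robust_hitting f (P n)) /\ dense (robust_hitting f (P n)).
  move=> f_tt n; have [Po P0] := P_pibase.1 (P n) (imageT P n).
  by split; [exact: open_robust_hitting | exact: dense_robust_hitting].
have DTrans := bigcap_robust_hitting_Trans f P P_pibase.
split=> [f_tt | X_Baire f_tt].
  have [x Dx] := bigcap_open_dense_neq0 _ X_cat2 (Dod f_tt).
  by exists x; exact: DTrans.
exists (\bigcap_n robust_hitting f (P n)); split => //.
  by exists (fun n => robust_hitting f (P n)) => // n; exact: (Dod f_tt n).1.
exact: X_Baire (Dod f_tt).
Qed.
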